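(* Let $t(n,k)$ be the number of paths in $\mathcal{M}'_2$ of length $n$ whose end-point has height $k$, and let $\mathit{Total}(z,u)=\sum_{n,k\ge 0}t(n,k)z^nu^k$ be the bivariate generating function of the paths in $\mathcal{M}'_2$ with respect to the length and the height of the end-point. Then $$\mathit{Total}(z,u)=\frac{1-u+z}{r-u},$$ and for every $k\ge 0$ $$[u^k]\,\mathit{Total}(z,u)=\frac{z+1}{r^{k+1}}-(1-[k=0])\frac{1}{r^{k}}.$$ Moreover, for $n\geq 1$, $k\geq 1$, $$t(n,k)=t(n,k-1)-t(n-1,k)+t(n-2,k+1)+t(n-1,k+1),$$ and, setting $t_n:=t(n,0)$, for $n\ge 1$, $$t_n=t_{n-1}+\sum_{k=1}^{n-2}t_kt_{n-1-k}.$$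
   Context: $\mathcal{M}'_2$ is the set of lattice paths in $\mathbb{N}^2$ (with $\mathbb{N}=\{0,1,2,\dots\}$, so paths never go below the $x$-axis) starting at the origin, made of up steps $(1,k)$ with $k\ge 1$, down steps $(1,-1)$ and horizontal steps $(1,0)$, in which every up step and every horizontal step, except possibly when it is the first step of the path, is immediately preceded by a down step. (They arise by reading from right to left paths with steps $(1,1)$, $(1,0)$, $(1,-k)$, $k\ge1$, in which each down or horizontal step other than the last step is immediately followed by $(1,1)$.) The empty path belongs to $\mathcal{M}'_2$. The length of a path is its number of steps; the height of a point is its ordinate. $[k=0]$ is $1$ if $k=0$ and $0$ otherwise. By convention $t(n,k)=0$ when $n<0$, and empty sums are $0$. The power series $r$ in $z$ is $$r=\frac{z+1+\sqrt{1-2z-3z^{2}}}{2},$$ where the square root is the power series with constant term $1$. The fraction $1/(r-u)$ is expanded as $\sum_{k\ge0}u^k/r^{k+1}$. *)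

(* Defs.v *)
From HB Require Import structures.
From mathcomp Require Import all_boot all_order all_algebra.
From mathcomp Require Import finmap zify.
From mathcomp Require Import boolp classical_sets cardinality.

Set Implicit Arguments.
Unset Strict Implicit.
Unset Printing Implicit Defensive.

Import Order.TTheory GRing.Theory Num.Theory.
Local Open Scope ring_scope.

(* Formal power series. The record keeps the Cauchy product apart from the
   pointwise operations on functions; [f n] is the coefficient of degree n. *)
Record fps (R : Type) := FPS { fps_coef :> nat -> R }.

Lemma fpsP (R : Type) (f g : fps R) : f =1 g -> f = g.
Proof. by case: f g => [f] [g] /= fg; congr FPS; apply/funext. Qed.

HB.instance Definition _ (R : Type) := gen_eqMixin (fps R).
HB.instance Definition _ (R : Type) := gen_choiceMixin (fps R).

Section Zmodule.
Variable V : zmodType.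
Implicit Types f g h : fps V.

Definition fps_zero : fps V := FPS (fun=> 0).
Definition fps_opp f : fps V := FPS (fun n => - f n).
Definition fps_add f g : fps V := FPS (fun n => f n + g n).

Fact fps_addA : associative fps_add.
Proof. by move=> f g h; apply: fpsP => n; rewrite /= addrA. Qed.
Fact fps_addC : commutative fps_add.
Proof. by move=> f g; apply: fpsP => n; rewrite /= addrC. Qed.
Fact fps_add0 : left_id fps_zero fps_add.
Proof. by move=> f; apply: fpsP => n; rewrite /= add0r. Qed.
Fact fps_addN : left_inverse fps_zero fps_opp fps_add.
Proof. by move=> f; apply: fpsP => n; rewrite /= addNr. Qed.

HB.instance Definition _ :=
  GRing.isZmodule.Build (fps V) fps_addA fps_addC fps_add0 fps_addN.

Lemma fpsD_coef f g n : (f + g) n = f n + g n. Proof. by []. Qed.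
Lemma fpsN_coef f n : (- f) n = - f n. Proof. by []. Qed.
Lemma fps0_coef n : (0 : fps V) n = 0. Proof. by []. Qed.

End Zmodule.

Section Ring.
Variable R : comNzRingType.
Implicit Types f g h : fps R.

Definition fps_one : fps R := FPS (fun n => (n == 0%N)%:R).
Definition fps_mul f g : fps R :=
  FPS (fun n => \sum_(i < n.+1) f i * g (n - i)%N).

Let trunc n f : {poly R} := \poly_(i < n.+1) f i.

Let trunc_coef n f i : (i <= n)%N -> (trunc n f)`_i = f i.
Proof. by move=> le_in; rewrite coef_poly ltnS le_in. Qed.

Let mul_coef n f g i : (i <= n)%N ->
  (trunc n f * trunc n g)`_i = fps_mul f g i.
Proof.
move=> le_in; rewrite coefM /=; apply: eq_bigr => j _.
have le_jn : (j <= n)%N by rewrite (leq_trans _ le_in) // -ltnS.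
by rewrite !trunc_coef // (leq_trans (leq_subr _ _) le_in).
Qed.

Fact fps_mulC : commutative fps_mul.
Proof. by move=> f g; apply: fpsP => n; rewrite -!(@mul_coef n) // mulrC. Qed.

Fact fps_mulA : associative fps_mul.
Proof.
move=> f g h; apply: fpsP => n.
transitivity ((trunc n f * (trunc n g * trunc n h))`_n).
  rewrite coefM /=; apply: eq_bigr => i _.
  by rewrite trunc_coef -1?ltnS // mul_coef ?leq_subr.
rewrite mulrA coefM /=; apply: eq_bigr => i _.
by rewrite mul_coef -1?ltnS // trunc_coef ?leq_subr.
Qed.

Fact fps_mul1 : left_id fps_one fps_mul.
Proof.
move=> f; apply: fpsP => n; rewrite /= big_ord_recl /= mul1r subn0 big1 ?addr0 //.
by move=> i _; rewrite mul0r.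
Qed.

Fact fps_mulDl : left_distributive fps_mul (@fps_add R).
Proof.
move=> f g h; apply: fpsP => n; rewrite /= -big_split /=.
by apply: eq_bigr => i _; rewrite mulrDl.
Qed.

Fact fps_oneNzero : fps_one != 0.
Proof.
apply/eqP => /(congr1 (fun f : fps R => f 0%N)) /= /eqP.
by rewrite oner_eq0.
Qed.

HB.instance Definition _ := GRing.Zmodule_isComNzRing.Build (fps R)
  fps_mulA fps_mulC fps_mul1 fps_mulDl fps_oneNzero.

Lemma fps1_coef n : (1 : fps R) n = (n == 0%N)%:R. Proof. by []. Qed.

Lemma fpsM_coef f g n : (f * g) n = \sum_(i < n.+1) f i * g (n - i)%N.
Proof. by []. Qed.

Lemma fpsM_coef0 f g : (f * g) 0%N = f 0%N * g 0%N.
Proof. by rewrite fpsM_coef big_ord1. Qed.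

Definition fpsX : fps R := FPS (fun n => (n == 1%N)%:R).
Definition fpsC (c : R) : fps R := FPS (fun n => if n == 0%N then c else 0).

End Ring.

Arguments fpsX {R}.

(* The sequence g with g n = F [:: g 0; ...; g (n - 1)]. *)
Definition course (T : Type) (F : seq T -> T) (n : nat) : T :=
  F (iter n (fun s => rcons s (F s)) [::]).

Lemma courseE (T : Type) (F : seq T -> T) n :
  course F n = F (mkseq (course F) n).
Proof.
by congr F; elim: n => // n IHn; rewrite mkseqS -IHn.
Qed.

Section Inverse.
Variable R : comUnitRingType.
Implicit Types f g : fps R.

Definition fps_unit : pred (fps R) := fun f => f 0%N \is a GRing.unit.

Definition fps_inv f : fps R :=
  if fps_unit f then
    FPS (course (fun s => (f 0%N)^-1 *
      ((size s == 0%N)%:R - \sum_(i < size s) s`_i * f (size s - i)%N)))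
  else f.

Fact fps_mulV : {in fps_unit, left_inverse 1 fps_inv *%R}.
Proof.
move=> f uf; have uf0 : f 0%N \is a GRing.unit by [].
apply: fpsP => n; rewrite /fps_inv [fps_unit f]uf fpsM_coef big_ord_recr /= subnn courseE size_mkseq.
rewrite mulrAC mulVr // mul1r addrC.
under [X in _ - X]eq_bigr => i _ do rewrite nth_mkseq //.
by rewrite subrK.
Qed.

Fact fps_unitPl f g : g * f = 1 -> fps_unit f.
Proof.
move=> /(congr1 (fun h : fps R => h 0%N)); rewrite fpsM_coef0 => gf.
by apply/unitrP; exists (g 0%N); split=> //; rewrite mulrC.
Qed.

Fact fps_inv_out : {in [predC fps_unit], fps_inv =1 id}.
Proof. by move=> f /negPf nuf; rewrite /fps_inv [fps_unit f]nuf. Qed.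

HB.instance Definition _ := GRing.ComNzRing_hasMulInverse.Build (fps R)
  fps_mulV fps_unitPl fps_inv_out.

Lemma fps_unitE f : (f \is a GRing.unit) = (f 0%N \is a GRing.unit).
Proof. by []. Qed.

End Inverse.

(* 1 / (c - u) = \sum_k u^k / c^(k+1) *)
Lemma fps_invCX (R : comUnitRingType) (c : R) : c \is a GRing.unit ->
  (fpsC c - fpsX \is a GRing.unit) /\
  (fpsC c - fpsX)^-1 = FPS (fun k => c ^- k.+1).
Proof.
move=> uc; have u : fpsC c - fpsX \is a GRing.unit.
  by rewrite fps_unitE fpsD_coef fpsN_coef /= subr0.
split=> //; apply: (mulrI u); rewrite divrr //; apply: fpsP => -[|n].
  by rewrite fpsM_coef0 fpsD_coef fpsN_coef /= subr0 divrr.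
rewrite fpsM_coef big_ord_recl big_ord_recl big1 => [|i _]; last first.
  by rewrite fpsD_coef fpsN_coef /= subr0 mul0r.
rewrite !fpsD_coef !fpsN_coef /= subr0 sub0r addr0 mulN1r subn0 subn1 /=.
by rewrite (exprS _ n.+1) invrM ?unitrX // mulrCA divrr // mulr1 subrr.
Qed.

(* For f with constant term 1, the square root of f with constant term 1. *)
Definition fps_sqrt (F : fieldType) (f : fps F) : fps F :=
  FPS (course (fun s => if size s == 0%N then 1 else
    (f (size s) - \sum_(1 <= i < size s) s`_i * s`_(size s - i)) / 2)).

Lemma fps_sqrtP (F : fieldType) (f : fps F) : (2 : F) != 0 -> f 0%N = 1 ->
  fps_sqrt f ^+ 2 = f /\ fps_sqrt f 0%N = 1.
Proof.
move=> n2 f0; have g0 : fps_sqrt f 0%N = 1 by [].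
split=> //; apply: fpsP => -[|n]; first by rewrite expr2 fpsM_coef0 g0 f0 mulr1.
rewrite expr2 fpsM_coef big_ord_recl big_ord_recr subn0 lift0 subnn g0.
rewrite mul1r mulr1 addrCA -mulr2n -mulr_natr [X in X * 2]courseE size_mkseq.
rewrite divfK // big_add1 big_mkord addrC.
under [X in _ - X]eq_bigr => i _ do
  rewrite !nth_mkseq ?ltnS ?subSS ?leq_subr ?(ltnW (ltn_ord i)) //.
exact: subrK.
Qed.

Lemma fps_sqrt_uniq (F : fieldType) (f g : fps F) : (2 : F) != 0 ->
  g ^+ 2 = f -> g 0%N = 1 -> g = fps_sqrt f.
Proof.
move=> n2 gf g0; have f0 : f 0%N = 1 by rewrite -gf expr2 fpsM_coef0 g0 mulr1.
have [sf s0] := fps_sqrtP n2 f0.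
have u : g + fps_sqrt f \is a GRing.unit.
  by rewrite fps_unitE fpsD_coef g0 s0 unitfE.
apply/eqP; rewrite -subr_eq0; apply/eqP; apply: (mulIr u).
by rewrite mul0r -subr_sqr gf sf subrr.
Qed.

(* A step (1, i) is represented by its rise i : i > 0 for an up step, i = 0 for
   a horizontal step, i = -1 for a down step. *)
Definition path_height (p : seq int) : int := \sum_(s <- p) s.

(* The i-th point of p, for i <= size p, has height path_height (take i p). *)
Definition M2' : set (seq int) := [set p : seq int |
  [/\ forall s, s \in p -> -1 <= s,
      forall i, (i <= size p)%N -> 0 <= path_height (take i p) &
      forall i, (i.+1 < size p)%N -> 0 <= p`_i.+1 -> p`_i = -1]]%classic.

Definition M2'_paths (n : int) (k : nat) : set (seq int) :=
  [set p | [/\ M2' p, (size p)%:Z = n & path_height p = k%:Z]]%classic.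

Lemma step_le (p : seq int) : (forall s, s \in p -> -1 <= s) ->
  forall s, s \in p -> s <= path_height p + (size p)%:Z.
Proof.
have nonneg (q : seq int) : (forall s : int, s \in q -> -1 <= s) ->
    0 <= path_height q + (size q)%:Z.
  elim: q => [|a q IHq] ge; first by rewrite /path_height big_nil.
  rewrite /path_height big_cons -/(path_height q) /=.
  have := ge a (mem_head _ _); have : 0 <= path_height q + (size q)%:Z.
    by apply: IHq => s sq; apply: ge; rewrite inE sq orbT.
  lia.
elim: p => // a p IHp ge s.
rewrite inE /path_height big_cons -/(path_height p) /=.
have gep s' : s' \in p -> -1 <= s' by move=> s'p; apply: ge; rewrite inE s'p orbT.
have ge0 := nonneg p gep; have gea := ge a (mem_head _ _).
move=> /predU1P[->|/(IHp gep)]; lia.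
Qed.

Lemma M2'_paths_finite (n : int) (k : nat) : finite_set (M2'_paths n k).
Proof.
case: n => n; last first.
  by apply: (@sub_finite_set _ _ set0) => // p [].
pose f (t : n.-tuple 'I_(k + n).+2) := [seq (val i)%:Z - 1 | i <- tval t].
apply: (@sub_finite_set _ _ (f @` setT)%classic); last first.
  by apply: finite_image; exact: finite_finset.
move=> p [[ge _ _] [sz] hp] /=.
pose g (s : int) : 'I_(k + n).+2 := inord (absz (s + 1)).
have szg : size (map g p) == n by rewrite size_map sz.
exists (Tuple szg) => //; rewrite /f /= -map_comp -[RHS]map_id.
apply/eq_in_map => s sp /=.
have s1 := ge s sp; have sk : s <= k%:Z + n%:Z by rewrite -hp -sz step_le.
by rewrite /g inordK; lia.
Qed.

(* t n k = 0 for n < 0, since no path has negative length. *)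
Definition t (n : int) (k : nat) : nat := #|` fset_set (M2'_paths n k)|%fset.

Definition z : fps rat := fpsX.

(* Q[[z]][[u]] stands for Q[[z, u]]; [fpsC] embeds Q[[z]] into it, and the
   coefficient of u^k in f is f k : fps rat. *)
Definition u : fps (fps rat) := fpsX.

Definition Total : fps (fps rat) :=
  FPS (fun k => FPS (fun n => (t n%:Z k)%:R)).

Definition r : fps rat := (z + 1 + fps_sqrt (1 - 2 * z - 3 * z ^+ 2)) / 2.

Lemma r_coef0 : r 0%N = 1.
Proof.
have u2 : (2 : fps rat) \is a GRing.unit by rewrite fps_unitE.
have s0 : fps_sqrt (1 - 2 * z - 3 * z ^+ 2) 0%N = 1 by [].
have := fpsM_coef0 r 2; rewrite /r divrK // !fpsD_coef s0.
by move/(congr1 (fun c : rat => c / 2)); rewrite mulfK.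
Qed.

Lemma r_unit : r \is a GRing.unit.
Proof. by rewrite fps_unitE r_coef0 unitr1. Qed.

Lemma inv_rBu : (fpsC r - u)^-1 = FPS (fun k => r ^- k.+1).
Proof. by have [] := fps_invCX r_unit. Qed.

(* Main.v *)
Require Import Defs.
From mathcomp Require Import all_boot all_order all_algebra.
From mathcomp Require Import finmap zify ring.
From mathcomp Require Import classical_sets cardinality.
Import GRing.Theory Num.Theory.
Local Open Scope ring_scope.

(** The recurrences come from the end of a path.  A path of length [n + 2] and
    final height [k] either ends with a down step, which may follow any path of
    length [n + 1] ending at height [k + 1], or ends with a horizontal or up
    step.  The latter is preceded by a down step, and the two together may
    follow any path of length [n] ending at a height between 1 and [k + 1],
    which determines the rise of the last step.  Hence ([t_last_step])
      t(n+2, k) = t(n+1, k+1) + sum over j <= k of t(n, j+1).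
    Subtracting this equation for [k - 1] from the one for [k] gives the
    recurrence for t(n, k).

    For the series T_k = [u^k] Total these recurrences read
      T_0 = 1 + z + (z + z^2) T_1,
      T_(k+1) = T_k - z T_(k+1) + (z + z^2) T_(k+2) - [k = 0]
    ([Total0_eq], [TotalS_eq]).  Every unknown on the right other than T_k
    carries a factor z, so the system has at most one solution
    ([catalytic_system_uniq]), although its recurrence goes upwards in k.
    Without the inhomogeneous term, T_k = w^k solves the recurrence exactly
    when 1 - (1 + z) w + z (1 + z) w^2 = 0, and w = 1/r is the root of this
    equation that is a power series ([rV_kernel]).  The closed form is checked
    to be a solution, which proves the formula for [u^k] Total; multiplying
    1 - u + z by the expansion of 1/(r - u) gives the same coefficients.

    Finally T_0 = (1 + z)/r, so the quadratic equation of 1/r becomes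
      T_0 = 1 + z - z T_0 + z T_0^2,
    and the recurrence for t_n is its coefficient of z^n: for n >= 2 the two
    extreme terms of the convolution are t_0 t_(n-1) = t_(n-1), and one of them
    is cancelled by - z T_0. *)

(** * Removing the last step of a path *)

Lemma path_height_rcons (q : seq int) (s : int) :
  path_height (rcons q s) = path_height q + s.
Proof. by rewrite /path_height -cats1 big_cat big_seq1. Qed.

(** The defining conditions of [M2'] concern prefixes and consecutive pairs of
    steps, so appending a step adds one condition of each kind; [q != [::]]
    exempts the first step of the path. *)
Lemma M2'_rcons (q : seq int) (s : int) :
  M2' (rcons q s) <->
  [/\ M2' q, -1 <= s, 0 <= path_height q + s &
      q != [::] -> 0 <= s -> last 0 q = -1].
Proof.
split=> [[ge1 ge0 down] | [[ge1 ge0 down] s1 hs lastq]].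
- split.
  + split=> [x xq|i iq|i iq].
    * by apply: ge1; rewrite mem_rcons inE xq orbT.
    * have := ge0 i; rewrite size_rcons -cats1 takel_cat //; apply; exact: leqW.
    * have := down i; rewrite size_rcons !nth_rcons iq (ltnW iq).
      by apply; exact: leqW.
  + by apply: ge1; rewrite mem_rcons mem_head.
  + by rewrite -path_height_rcons -[rcons q s]take_size ge0.
  + case: q down {ge1 ge0} => // x q down _ s0.
    have := down (size q); rewrite size_rcons /= ltnSn nth_rcons ltnn eqxx.
    by move=> /(_ isT s0); rewrite -rcons_cons nth_rcons /= ltnSn -last_nth.
- split=> [x|i|i].
  + by rewrite mem_rcons inE => /predU1P[->|/ge1].
  + rewrite size_rcons leq_eqVlt ltnS => /predU1P[->|iq].
      by rewrite take_oversize ?size_rcons // path_height_rcons.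
    by rewrite -cats1 takel_cat // ge0.
  + rewrite size_rcons ltnS => iq; rewrite !nth_rcons iq.
    case: (ltngtP i.+1 (size q)) iq => // [iq _ | iq _ s0]; first exact: down.
    rewrite -lastq //; last by case: (q) iq.
    by rewrite -nth_last -iq.
Qed.

Lemma M2'_nil : M2' [::].
Proof. by split=> // i _; rewrite /path_height big_nil. Qed.

(** A down step is subject to no condition on its predecessor. *)
Lemma M2'_rcons_down (q : seq int) :
  M2' (rcons q (-1)) <-> M2' q /\ 1 <= path_height q.
Proof.
rewrite M2'_rcons; split=> [[Mq _ hq _]|[Mq hq]]; first by split=> //; lia.
by split=> //; lia.
Qed.

(** * Enumeration and counting of the paths *)

(** Paths of length [n] and final height [k].  In the last case [j.+1] is the
    height reached before the final pair of steps, hence [j] the height after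
    its down step, and the last step has to rise by [k - j]. *)
Fixpoint paths (n k : nat) : seq (seq int) :=
  match n with
  | 0 => if k == 0%N then [:: [::]] else [::]
  | 1 => [:: [:: k%:Z]]
  | (m.+1 as n').+1 =>
      [seq rcons q (-1)%R | q <- paths n' k.+1] ++
      [seq rcons (rcons q (-1)%R) (k - j)%N%:Z%R
         | j <- iota 0 k.+1, q <- paths m j.+1]
  end%N.

(** Keeps the comprehension over [iota 0 k.+1] folded, which simplification
    would unroll. *)
Lemma pathsSS (n k : nat) :
  paths n.+2 k =
    [seq rcons q (-1) | q <- paths n.+1 k.+1] ++
    [seq rcons (rcons q (-1)) (k - j)%N%:Z
       | j <- iota 0 k.+1, q <- paths n j.+1].
Proof. by []. Qed.

Lemma pathsP (n k : nat) (p : seq int) :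
  reflect (M2'_paths n%:Z k p) (p \in paths n k).
Proof.
apply/(iffP idP).
- elim/ltn_ind: n k p => -[|[|n]] IHn k p.
  + rewrite /=; case: eqP => // -> /[!inE] /eqP ->.
    by split=> //; [exact: M2'_nil | rewrite /path_height big_nil].
  + rewrite /= inE => /eqP ->; split=> //; last by rewrite /path_height big_seq1.
    rewrite -[[:: _]]/(rcons [::] _) M2'_rcons /path_height big_nil.
    by split=> //; first exact: M2'_nil.
  + rewrite pathsSS mem_cat => /orP[/mapP[q]|/allpairsPdep[j [q [+ + ->]]]].
    * move=> /IHn[] // Mq sq hq ->; split.
      - by apply/M2'_rcons_down; split=> //; lia.
      - by rewrite size_rcons; lia.
      - by rewrite path_height_rcons; lia.
    * rewrite mem_iota => /andP[_ jk] /IHn[|Mq sq hq]; first lia.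
      split; last 2 first.
      - by rewrite !size_rcons; lia.
      - by rewrite !path_height_rcons; lia.
      apply/M2'_rcons; rewrite path_height_rcons last_rcons; split=> //; try lia.
      by apply/M2'_rcons_down; split=> //; lia.
- elim/ltn_ind: n k p => -[|[|n]] IHn k p.
  + by case=> _ /= [/size0nil ->]; rewrite /path_height big_nil => -[<-].
  + case: p => [|x [|y p]] [_ sp] //; rewrite /path_height big_seq1 => ->.
    by rewrite /= mem_head.
  + case/lastP: p => [|q s] [+ sp +]; first by case: sp.
    move: sp; rewrite size_rcons => sp.
    rewrite M2'_rcons path_height_rcons => -[Mq s1 hs lastq] hk.
    have [s0|s0] := boolP (0 <= s).
    * have /lastq/(_ s0) : q != [::] by case: (q) sp.
      case/lastP: q Mq sp hs hk {lastq} => [|q x] // Mq + hs hk.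
      rewrite size_rcons last_rcons => sp xE; move: Mq hs hk.
      rewrite xE path_height_rcons => /M2'_rcons_down[Mq hq] hs hk.
      rewrite pathsSS mem_cat; apply/orP; right; apply/allpairsPdep.
      exists `|path_height q - 1|%N, q; split.
      - by rewrite mem_iota; lia.
      - by apply: IHn; [lia | split=> //; lia].
      - by congr rcons; lia.
    * have sE : s = -1 by lia.
      rewrite sE pathsSS mem_cat (map_f (rcons^~ (-1))) //.
      by apply: IHn => //; split=> //; lia.
Qed.

Lemma paths_uniq (n k : nat) : uniq (paths n k).
Proof.
elim/ltn_ind: n k => -[|[|n]] IHn k; [by case: k | by [] |].
rewrite pathsSS cat_uniq; apply/and3P; split.
- by rewrite map_inj_uniq ?IHn // => x y /rcons_inj[].
- apply/hasPn => _ /allpairsPdep[j [q [_ _ ->]]].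
  by apply/mapP => -[q' _ /rcons_inj[_]]; lia.
- apply: allpairs_uniq_dep => [|j _|]; [exact: (iota_uniq 0 k.+1)| exact: IHn |].
  move=> _ _ /allpairsPdep[i [q [+ _ ->]]] /allpairsPdep[j [q' [+ _ ->]]] /=.
  rewrite !mem_iota => ik jk /rcons_inj[/rcons_inj[->] ij].
  by have -> : i = j by lia.
Qed.

Lemma t_paths (n k : nat) : t n%:Z k = size (paths n k).
Proof.
rewrite /t.
have -> : M2'_paths n%:Z k = [set` [fset p in paths n k]%fset]%classic.
  apply/seteqP; split=> p /=; first by move/pathsP; rewrite !inE.
  by rewrite !inE => /pathsP.
by rewrite set_fsetK card_fseq undup_id ?paths_uniq.
Qed.

Lemma t_neg (n : int) (k : nat) : n < 0 -> t n k = 0%N.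
Proof.
move=> n0; rewrite /t.
suff -> : M2'_paths n k = set0 by rewrite fset_set0 cardfs0.
by rewrite -subset0 => p [_ sp _]; lia.
Qed.

Lemma t0 (k : nat) : t 0 k = (k == 0%N).
Proof. by rewrite (t_paths 0); case: k. Qed.

Lemma t1 (k : nat) : t 1 k = 1%N.
Proof. by rewrite (t_paths 1). Qed.

Lemma t_last_step (n k : nat) :
  t n.+2%:Z k = (t n.+1%:Z k.+1 + \sum_(j < k.+1) t n%:Z j.+1)%N.
Proof.
rewrite !t_paths pathsSS size_cat size_map size_allpairs_dep sumnE big_map.
rewrite -[iota 0 k.+1]/(index_iota 0 k.+1) big_mkord.
by congr addn; apply: eq_bigr => j _; rewrite t_paths.
Qed.

(** For [2 <= n] the sums in [t_last_step] for [k] and for [k - 1] differ by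
    one summand, so subtraction removes them; [n = 1] is a case of its own, since
    a path of length 1 has no last pair of steps. *)
Lemma t_rec (n k : nat) : (1 <= n)%N -> (1 <= k)%N ->
  (t n%:Z k)%:Z = (t n%:Z (k - 1))%:Z - (t (n%:Z - 1) k)%:Z
    + (t (n%:Z - 2) k.+1)%:Z + (t (n%:Z - 1) k.+1)%:Z.
Proof.
case: n => [|[|n]] // _; case: k => // k _.
- by rewrite subrr (@t_neg (1 - 2)) // !t1 !t0.
- have -> : n.+2%:Z - 1 = n.+1 by lia.
  have -> : n.+2%:Z - 2 = n by lia.
  by rewrite subn1 /= !t_last_step [in LHS]big_ord_recr /=; lia.
Qed.

(** * The power series satisfied by the counting sequence *)

Lemma fpsX_coefM0 (R : comNzRingType) (f : fps R) : (fpsX * f) 0%N = 0.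
Proof. by rewrite fpsM_coef0 mul0r. Qed.

Lemma fpsX_coefMS (R : comNzRingType) (f : fps R) (n : nat) :
  (fpsX * f) n.+1 = f n.
Proof.
rewrite fpsM_coef !big_ord_recl big1 => [|i _]; last by rewrite mul0r.
by rewrite mul0r mul1r add0r addr0 /= subn1.
Qed.

Definition fpsX_coefM := (fpsX_coefM0, fpsX_coefMS).

Lemma fpsC_coefM (R : comNzRingType) (c : R) (f : fps R) (n : nat) :
  (fpsC c * f) n = c * f n.
Proof.
rewrite fpsM_coef big_ord_recl subn0 big1 ?addr0 // => i _.
by rewrite mul0r.
Qed.

(** Applied to the difference [D] of two solutions.  The coefficients of degree
    [n] vanish by induction on [n]: in that degree [z * D k] involves only lower
    coefficients, which vanish for all [k] at once, and the system reduces to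
    [D 0 = 0] and [D k.+1 = D k], which an inner induction on [k] exploits. *)
Lemma catalytic_system_uniq (D : nat -> fps rat) :
  D 0%N = (z + z ^+ 2) * D 1%N ->
  (forall k, D k.+1 = D k - z * D k.+1 + (z + z ^+ 2) * D k.+2) ->
  forall k, D k = 0.
Proof.
move=> D0 DS k; apply: fpsP => n; rewrite fps0_coef.
elim/ltn_ind: n k => n IHn.
have zD k : (z * D k) n = 0.
  by case: n IHn => [|n] IHn; rewrite fpsX_coefM ?IHn.
have zzD k : ((z + z ^+ 2) * D k) n = 0.
  rewrite mulrDl expr2 -mulrA fpsD_coef zD add0r.
  by case: n IHn {zD} => [|[|n]] IHn; rewrite !fpsX_coefM ?IHn.
elim=> [|k IHk]; first by rewrite D0 zzD.
by rewrite DS !fpsD_coef fpsN_coef zD zzD IHk subr0 addr0.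
Qed.

Lemma Total0_eq : Total 0%N = 1 + z + (z + z ^+ 2) * Total 1%N.
Proof.
apply: fpsP => n; rewrite mulrDl expr2 -mulrA !fpsD_coef.
case: n => [|[|n]]; rewrite !fpsX_coefM /= ?(t0, t1) //.
by rewrite t_last_step big_ord1 natrD !add0r.
Qed.

(** In positive degree this is [t_rec]; in degree 0 the only path is the empty
    one, whose contribution 1 to [Total 0] the term [(k == 0)%:R] cancels. *)
Lemma TotalS_eq (k : nat) :
  Total k.+1 = Total k - z * Total k.+1 + (z + z ^+ 2) * Total k.+2
               - (k == 0%N)%:R.
Proof.
apply: fpsP => n; rewrite mulrDl expr2 -mulrA !fpsD_coef !fpsN_coef.
case: n => [|n]; rewrite !fpsX_coefM; first by rewrite /= !t0; case: k.
have -> : ((k == 0%N)%:R : fps rat) n.+1 = 0 by case: (k == 0%N).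
have -> : Total k.+1 n.+1 =
    (t n.+1 k)%:R - (t n k.+1)%:R + (z * Total k.+2) n + (t n k.+2)%:R.
  have -> : (z * Total k.+2) n = (t (n.+1%:Z - 2) k.+2)%:R.
    case: n => [|n]; rewrite fpsX_coefM; first by rewrite t_neg.
    by have -> : n.+2%:Z - 2 = n by lia.
  have := congr1 (intr : int -> rat) (@t_rec n.+1 k.+1 isT isT).
  rewrite !(rmorphD, rmorphB, rmorphN) /= -!pmulrn subn1 /= => ->.
  by have -> : n.+1%:Z - 1 = n by lia.
by rewrite subr0 [in RHS]addrA addrAC.
Qed.

(** * Solution of the system by the root of the kernel *)

(** [1 - 2z - 3z^2 = (z + 1)^2 - 4z(z + 1)] is the discriminant of this equation
    in [r]. *)
Lemma r_quadratic : r ^+ 2 = (z + 1) * r - z * (z + 1).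
Proof.
have u2 : (2 : fps rat) \is a GRing.unit by rewrite fps_unitE.
have f0 : (1 - 2 * z - 3 * z ^+ 2) 0%N = 1.
  by rewrite !fpsD_coef !fpsN_coef !fpsM_coef0 /= !mulr0 !subr0.
have [] := fps_sqrtP (isT : (2 : rat) != 0) f0.
have : r * 2 = z + 1 + fps_sqrt (1 - 2 * z - 3 * z ^+ 2) by rewrite /r divrK.
move: (fps_sqrt _) => s rE sE _.
(* After multiplication by 4 only [2 * r], a polynomial in the square root,
   occurs. *)
apply: (mulIr u2); apply: (mulIr u2); apply: subr0_eq.
transitivity ((r * 2) ^+ 2 - 2 * (z + 1) * (r * 2) + 4 * z * (z + 1)); first ring.
rewrite rE; transitivity (s ^+ 2 - (1 - 2 * z - 3 * z ^+ 2)); first ring.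
by rewrite sE subrr.
Qed.

Lemma rV_kernel : 1 - (z + 1) * r^-1 + z * (z + 1) * r^-1 ^+ 2 = 0.
Proof.
apply: (mulIr (unitrX 2 r_unit)); rewrite mul0r.
have rVr : r^-1 * r = 1 by rewrite mulVr // r_unit.
transitivity (r ^+ 2 - (z + 1) * r * (r^-1 * r)
  + z * (z + 1) * (r^-1 * r) ^+ 2); first ring.
by rewrite rVr r_quadratic; ring.
Qed.

(** In both equations of the system the defect of the closed form is a multiple
    of the kernel [Q], which vanishes at [1 / r]. *)
Lemma Total_coef (k : nat) :
  Total k = (z + 1) * r^-1 ^+ k.+1 - (1 - (k == 0%N)%:R) * r^-1 ^+ k.
Proof.
move: r^-1 rV_kernel => w wE; apply: subr0_eq; move: k.
pose Q := 1 - (z + 1) * w + z * (z + 1) * w ^+ 2.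
apply: catalytic_system_uniq => [|k].
- rewrite Total0_eq /=; apply: subr0_eq; transitivity ((z + 1) * Q).
    by rewrite /Q; ring.
  by rewrite [Q]wE mulr0.
- rewrite [X in X - _ = _]TotalS_eq; apply: subr0_eq.
  transitivity (Q * ((z + 1) * w ^+ k.+1 - w ^+ k)).
    rewrite /Q /= !exprS; case: k => [|k] /=; ring.
  by rewrite [Q]wE mul0r.
Qed.

(** The kernel equation for [w = 1 / r], multiplied by [1 + z] and rewritten in
    terms of [(1 + z) * w]. *)
Lemma Total0_quadratic :
  Total 0%N = 1 + z - z * Total 0%N + z * (Total 0%N * Total 0%N).
Proof.
rewrite Total_coef subrr mul0r subr0 expr1.
move: r^-1 rV_kernel => w wE; apply: subr0_eq.
transitivity (- (z + 1) * (1 - (z + 1) * w + z * (z + 1) * w ^+ 2)); first ring.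
by rewrite wE mulr0.
Qed.

Lemma t0_rec (n : nat) : (1 <= n)%N ->
  t n%:Z 0 = (t (n%:Z - 1) 0
    + \sum_(1 <= k < n - 1) t k%:Z 0 * t (n%:Z - 1 - k%:Z) 0)%N.
Proof.
case: n => [|[|n]] // _; first by rewrite big_geq // t1 subrr t0.
have : Total 0%N n.+2 = _ :=
  congr1 (fun f : fps rat => f n.+2) Total0_quadratic.
rewrite !fpsD_coef !fpsN_coef !fpsX_coefM fpsM_coef.
rewrite big_ord_recl big_ord_recr /= subn0 subnn.
have -> : n.+2%:Z - 1 = n.+1 by lia.
rewrite t0 !mul1r mulr1 subn1 big_add1 big_mkord => E.
apply/eqP; rewrite -(eqr_nat rat) E natrD natr_sum; apply/eqP.
(* The extreme terms of the convolution are both [t n.+1 0]; one of them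
   cancels the contribution of [- z * Total 0]. *)
rewrite !add0r addrA addrC addrA addrK addrC; congr (_ + _).
apply: eq_bigr => i _; rewrite natrM; congr (_ * (t _ 0)%:R).
by rewrite /bump /=; have := ltn_ord i; lia.
Qed.

Theorem theorem4 :
  [/\ Total = (1 - u + fpsC z) / (fpsC r - u),
      forall k : nat,
        Total k = (z + 1) / r ^+ k.+1 - (1 - (k == 0%N)%:R) * (1 / r ^+ k),
      forall n k : nat, (1 <= n)%N -> (1 <= k)%N ->
        (t n%:Z k)%:Z = (t n%:Z (k - 1))%:Z - (t (n%:Z - 1) k)%:Z
          + (t (n%:Z - 2) k.+1)%:Z + (t (n%:Z - 1) k.+1)%:Z
    & forall n : nat, (1 <= n)%N ->
        t n%:Z 0 = (t (n%:Z - 1) 0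
          + \sum_(1 <= k < n - 1) t k%:Z 0 * t (n%:Z - 1 - k%:Z) 0)%N].
Proof.
split; last 2 first.
- exact: t_rec.
- exact: t0_rec.
- apply: fpsP => k; rewrite Total_coef inv_rBu.
  rewrite [in RHS]mulrDl [in RHS]mulrBl mul1r.
  rewrite !fpsD_coef fpsN_coef fpsC_coefM.
  by case: k => [|k]; rewrite fpsX_coefM /= -!exprVn; ring.
- by move=> k; rewrite Total_coef div1r !exprVn.
Qed.
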